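(* Let $(X,M,\pi_1)$, $(Y,M,\pi_2)$ be bundles with metric fibers and $u:M\to M$ a map. Let $H:X\times Y\to X\times Y$ be a bundle correspondence over $u$ with generating bundle map $(F,G)$, and let $\varepsilon_1:M\to\mathbb R_+$. Assume: (i) $i=(i_X,i_Y):M\to X\times Y$ is a section such that $\widetilde d(G_m(X_m,i_Y(u(m))),i_Y(m))\le\eta(m)$ for all $m\in M$, where $\eta:M\to\mathbb R_+$ satisfies $\eta(u(m))\le\varepsilon(m)\eta(m)$ with $0\le\varepsilon(m)\le\varepsilon_1(m)$ for all $m\in M$; and one of the following two conditions holds: (ii) $H$ satisfies the (A$'$)$(\alpha,\lambda_u)$ (B)$(\beta;\beta',\lambda_s)$ condition, where $\alpha,\lambda_u,\beta,\beta',\lambda_s:M\to\mathbb R_+$, and (a) $\sup_m\alpha(m)\beta'(u(m))<1$, $\beta'(u(m))\le\beta(m)$ for all $m$, $\sup_m\{\alpha(m),\beta(m)\}<\infty$; (b) $\sup_m\dfrac{\lambda_u(m)\varepsilon_1(m)}{1-\alpha(m)\beta'(u(m))}<1$; (ii)$'$ or $H$ satisfies the (A)$(\alpha;\alpha',\lambda_u)$ (B)$(\beta;\beta',\lambda_s)$ condition, where $\alpha,\beta,\alpha',\beta',\lambda_u,\lambda_s:M\to\mathbb R_+$, and (a)$'$ $\sup_m\alpha'(m)\beta'(u(m))<1$, $\alpha'(m)\le\alpha(u(m))$, $\beta'(u(m))\le\beta(m)$ for all $m$, $\sup_m\{\alpha(m),\beta(m)\}<\infty$; (b)$'$ $\sup_m\lambda_u(m)\varepsilon_1(m)<1$.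 Then there is a unique bundle map $f:X\to Y$ over $\mathrm{id}$ such that: (1) $\operatorname{Lip}f_m\le\beta'(m)$ and $\widetilde d(f_m(X_m),i_Y(m))\le K\eta(m)$ for all $m\in M$, where $K\ge0$ is a constant. (2) $\operatorname{Graph}f\subset H^{-1}\operatorname{Graph}f$; more precisely, $(x_m(x),f_{u(m)}(x_m(x)))\in H_m(x,f_m(x))$ for all $x\in X_m$, where $x_m(\cdot):X_m\to X_{u(m)}$ satisfies $\operatorname{Lip}x_m(\cdot)\le\lambda_s(m)$ for all $m\in M$. In addition, if $\widetilde d(F_m(X_m,i_Y(u(m))),i_X(u(m)))\le\eta(u(m))$ for all $m\in M$, then $\widetilde d(x_m(X_m),i_X(u(m)))\le K_0\eta(u(m))$ for all $m\in M$ and some constant $K_0$. (3) $f$ does not depend on the choice of $\eta$: replacing $\eta$ by any $\eta':M\to\mathbb R_+$ such that $\eta'(u(m))\le\varepsilon'(m)\eta'(m)$, $\varepsilon'(m)\le\varepsilon_1(m)$ and $\eta(m)\le\eta'(m)$ for all $m\in M$ yields the same $f$.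
   Context: A bundle with metric fibers $(X,M,\pi)$ is a surjection $\pi:X\to M$ of sets such that every fiber $X_m=\pi^{-1}(m)$ is a complete metric space; all metrics are written $d(x,y)=|x-y|$. For a subset $A$ of a metric space and a point $z$, $\widetilde d(A,z)=\sup_{\tilde z\in A}d(\tilde z,z)$. $X\times Y$ is the bundle over $M$ with fibers $X_m\times Y_m$. A section $i$ has $i(m)=(i_X(m),i_Y(m))\in X_m\times Y_m$. A bundle map $f:X\to Y$ over $\mathrm{id}$ is a family of maps $f_m:X_m\to Y_m$. A correspondence $H:A\to B$ is a nonempty subset $\operatorname{Graph}H\subset A\times B$; $H(a)=\{b:(a,b)\in\operatorname{Graph}H\}$; $A'\subset H^{-1}(B')$ means that for every $a\in A'$ there is $b\in B'$ with $b\in H(a)$. A correspondence $H:X_1\times Y_1\to X_2\times Y_2$ has generating map $(F,G)$ (written $H\sim(F,G)$), $F:X_1\times Y_2\to X_2$, $G:X_1\times Y_2\to Y_1$, if $(x_2,y_2)\in H(x_1,y_1)\iff y_1=G(x_1,y_2),\ x_2=F(x_1,y_2)$. A bundle correspondence over $u$ with generating bundle map $(F,G)$ is a family $H_m\sim(F_m,G_m):X_m\times Y_m\to X_{u(m)}\times Y_{u(m)}$, $m\in M$. For $H\sim(F,G):X_1\times Y_1\to X_2\times Y_2$ and constants, conditions are required for all $(x_1,y_1)\times(x_2,y_2)$, $(x_1',y_1')\times(x_2',y_2')\in\operatorname{Graph}H$: (A)$(\alpha;\alpha',\lambda_u)$: if $|x_1-x_1'|\le\alpha|y_1-y_1'|$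 then $|x_2-x_2'|\le\alpha'|y_2-y_2'|$ and $|y_1-y_1'|\le\lambda_u|y_2-y_2'|$. (B)$(\beta;\beta',\lambda_s)$: if $|y_2-y_2'|\le\beta|x_2-x_2'|$ then $|y_1-y_1'|\le\beta'|x_1-x_1'|$ and $|x_2-x_2'|\le\lambda_s|x_1-x_1'|$. (A$'$)$(\alpha,\lambda_u)$: $\sup_x\operatorname{Lip}F(x,\cdot)\le\alpha$ and $\sup_x\operatorname{Lip}G(x,\cdot)\le\lambda_u$. A bundle correspondence satisfies such a condition with functions $\alpha,\dots:M\to\mathbb R_+$ if each $H_m$ satisfies it with the values at $m$. *)

(* Defs.v *)
From HB Require Import structures.
From mathcomp Require Import all_boot all_order all_algebra.
From mathcomp Require Import all_classical all_reals all_analysis.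

Set Implicit Arguments.
Unset Strict Implicit.
Unset Printing Implicit Defensive.

Import Order.TTheory GRing.Theory Num.Theory.

Local Open Scope classical_set_scope.
Local Open Scope ring_scope.

(* The library's [Complete] structure is pointed, so these are exactly the
   nonempty complete metric spaces (with a distinguished point that nothing
   below uses). *)
#[short(type="completeMetricType")]
HB.structure Definition CompleteMetric (R : numDomainType) :=
  {T of Complete T & Metric R T}.

(* A bundle is given by its fibers; the total space is [{m : M & X m}] and the
   projection is [projT1], which is surjective because every fiber is
   nonempty. *)
Definition metric_bundle (R : realType) (M : Type) := M -> completeMetricType R.

Definition bundle_map (R : realType) (M : Type) (X Y : metric_bundle R M) :=
  forall m : M, X m -> Y m.

Definition prod_section (R : realType) (M : Type) (X Y : metric_bundle R M) :=
  forall m : M, (X m * Y m)%type.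

(* The best Lipschitz constant, possibly +oo.  Pairs on the diagonal contribute
   0 / 0 = 0 to the supremum, so that it is never -oo on a nonempty space. *)
Definition Lip (R : realType) (A B : metricType R) (f : A -> B) : \bar R :=
  ereal_sup [set (mdist (f p.1) (f p.2) / mdist p.1 p.2)%:E | p in [set: A * A]].

Definition dtilde (R : realType) (T : metricType R) (A : set T) (z : T)
    : \bar R :=
  ereal_sup [set (mdist w z)%:E | w in A].

Definition supE (R : realType) (M : Type) (g : M -> R) : \bar R :=
  ereal_sup (range (fun m => (g m)%:E)).

Record correspondence (A B : Type) := Correspondence {
  corr_graph : set (A * B);
  corr_graph_nonempty : corr_graph !=set0
}.

Definition corr_app (A B : Type) (H : correspondence A B) (a : A) : set B :=
  [set b | corr_graph H (a, b)].

Coercion corr_app : correspondence >-> Funclass.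

Definition corr_preimage (A B : Type) (H : correspondence A B) (B' : set B)
    : set A :=
  [set a | exists2 b, B' b & H a b].

Definition fun_graph (A B : Type) (f : A -> B) : set (A * B) :=
  [set p | p.2 = f p.1].

Definition generated_by (X1 Y1 X2 Y2 : Type)
    (H : correspondence (X1 * Y1) (X2 * Y2))
    (F : X1 -> Y2 -> X2) (G : X1 -> Y2 -> Y1) : Prop :=
  forall x1 y1 x2 y2,
    H (x1, y1) (x2, y2) <-> y1 = G x1 y2 /\ x2 = F x1 y2.

Section Conditions.
Context (R : realType) (X1 Y1 X2 Y2 : metricType R).

Definition condA (H : correspondence (X1 * Y1) (X2 * Y2))
    (a a' lu : R) : Prop :=
  forall x1 y1 x2 y2 x1' y1' x2' y2',
    H (x1, y1) (x2, y2) -> H (x1', y1') (x2', y2') ->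
    mdist x1 x1' <= a * mdist y1 y1' ->
    mdist x2 x2' <= a' * mdist y2 y2' /\ mdist y1 y1' <= lu * mdist y2 y2'.

Definition condB (H : correspondence (X1 * Y1) (X2 * Y2))
    (b b' ls : R) : Prop :=
  forall x1 y1 x2 y2 x1' y1' x2' y2',
    H (x1, y1) (x2, y2) -> H (x1', y1') (x2', y2') ->
    mdist y2 y2' <= b * mdist x2 x2' ->
    mdist y1 y1' <= b' * mdist x1 x1' /\ mdist x2 x2' <= ls * mdist x1 x1'.

Definition condA' (F : X1 -> Y2 -> X2) (G : X1 -> Y2 -> Y1)
    (a lu : R) : Prop :=
  (ereal_sup (range (fun x => Lip (F x))) <= a%:E)%E /\
  (ereal_sup (range (fun x => Lip (G x))) <= lu%:E)%E.

End Conditions.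

Definition nonneg_fun (R : realType) (M : Type) (g : M -> R) : Prop :=
  forall m, 0 <= g m.

Section BundleCorrespondences.
Context (R : realType) (M : Type) (X Y : metric_bundle R M) (u : M -> M).

Definition bundle_corr :=
  forall m, correspondence (X m * Y m) (X (u m) * Y (u m)).

Definition bundle_generated_by (H : bundle_corr)
    (F : forall m, X m -> Y (u m) -> X (u m))
    (G : forall m, X m -> Y (u m) -> Y m) : Prop :=
  forall m, generated_by (H m) (F m) (G m).

Definition condA'B_hyps (H : bundle_corr)
    (F : forall m, X m -> Y (u m) -> X (u m))
    (G : forall m, X m -> Y (u m) -> Y m)
    (eps1 alpha beta beta' lambda_u lambda_s : M -> R) : Prop :=
  [/\ [/\ nonneg_fun alpha, nonneg_fun lambda_u, nonneg_fun beta,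
          nonneg_fun beta' & nonneg_fun lambda_s],
      (forall m, condA' (F m) (G m) (alpha m) (lambda_u m)) /\
      (forall m, condB (H m) (beta m) (beta' m) (lambda_s m)),
      [/\ (supE (fun m => alpha m * beta' (u m))%R < 1)%E,
          forall m, beta' (u m) <= beta m &
          (supE (fun m => Num.max (alpha m) (beta m))%R < +oo)%E] &
      (supE (fun m => lambda_u m * eps1 m / (1 - alpha m * beta' (u m)))%R < 1)%E].

Definition condAB_hyps (H : bundle_corr)
    (eps1 alpha alpha' beta beta' lambda_u lambda_s : M -> R) : Prop :=
  [/\ nonneg_fun alpha' /\
      [/\ nonneg_fun alpha, nonneg_fun lambda_u, nonneg_fun beta,
          nonneg_fun beta' & nonneg_fun lambda_s],
      (forall m, condA (H m) (alpha m) (alpha' m) (lambda_u m)) /\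
      (forall m, condB (H m) (beta m) (beta' m) (lambda_s m)),
      [/\ (supE (fun m => alpha' m * beta' (u m))%R < 1)%E,
          forall m, alpha' m <= alpha (u m),
          forall m, beta' (u m) <= beta m &
          (supE (fun m => Num.max (alpha m) (beta m))%R < +oo)%E] &
      (supE (fun m => lambda_u m * eps1 m)%R < 1)%E].

Definition lipschitz_near (i : prod_section X Y) (beta' eta : M -> R)
    (f : bundle_map X Y) : Prop :=
  exists2 K : R, 0 <= K &
    forall m, (Lip (f m) <= (beta' m)%:E)%E /\
              (dtilde (range (f m)) (i m).2 <= (K * eta m)%:E)%E.

Definition base_dynamics (H : bundle_corr) (lambda_s : M -> R)
    (f : bundle_map X Y) (xi : forall m, X m -> X (u m)) : Prop :=
  (forall m x, H m (x, f m x) (xi m x, f (u m) (xi m x))) /\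
  (forall m, (Lip (xi m) <= (lambda_s m)%:E)%E).

Definition invariant_graph (H : bundle_corr) (lambda_s : M -> R)
    (f : bundle_map X Y) : Prop :=
  (forall m, fun_graph (f m) `<=` corr_preimage (H m) (fun_graph (f (u m)))) /\
  exists xi, base_dynamics H lambda_s f xi.

(* By [base_dynamics] and the (B) condition the map [xi] is determined by [f],
   so quantifying over all [xi] refers to the one of [invariant_graph]. *)
Definition base_estimate (H : bundle_corr)
    (F : forall m, X m -> Y (u m) -> X (u m))
    (i : prod_section X Y) (lambda_s eta : M -> R) (f : bundle_map X Y)
    : Prop :=
  (forall m, (dtilde (range (fun x => F m x (i (u m)).2)) (i (u m)).1
              <= (eta (u m))%:E)%E) ->
  forall xi, base_dynamics H lambda_s f xi ->
  exists K0 : R,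
    forall m, (dtilde (range (xi m)) (i (u m)).1 <= (K0 * eta (u m))%:E)%E.

Definition the_invariant_graph (H : bundle_corr)
    (F : forall m, X m -> Y (u m) -> X (u m)) (i : prod_section X Y)
    (beta' lambda_s eta : M -> R) (f : bundle_map X Y) : Prop :=
  unique (fun g => lipschitz_near i beta' eta g /\ invariant_graph H lambda_s g)
    f /\
  base_estimate H F i lambda_s eta f.

End BundleCorrespondences.

(* Main.v *)
(* The graph transform of f is the bundle map g with Graph g contained in
   H^-1(Graph f): g x = G(x, f z), where z = F(x, f z) has a unique solution by
   Banach's fixed point theorem since Lip F * Lip f < 1.  By (B) the transform
   preserves the bound Lip <= beta', and (A) or (A') makes its n-th iterate
   shrink the distance weighted by eta by a factor O(theta^n).  The iterates of
   the constant maps i_Y therefore converge to the unique invariant graph at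
   finite weighted distance from i_Y.  As eta' >= eta weakens that distance, the
   limit for eta is also the one for eta'. *)
Require Import Defs.
From HB Require Import structures.
From mathcomp Require Import all_boot all_order all_algebra.
From mathcomp Require Import all_classical all_reals all_analysis.
From mathcomp Require Import lra.

Set Implicit Arguments.
Unset Strict Implicit.
Unset Printing Implicit Defensive.

Import Order.TTheory GRing.Theory Num.Theory.
Import numFieldNormedType.Exports.

Local Open Scope classical_set_scope.
Local Open Scope ring_scope.

(** * Geometric convergence and fixed points in complete metric spaces *)

Lemma le_add_geometric (R : realType) (theta K a b : R) :
  0 <= theta < 1 -> (forall n, a <= b + K * theta ^+ n) -> a <= b.
Proof.
move=> /andP[t0 t1] abn.
have t_cvg : geometric K theta n @[n --> \oo] --> 0.
  by apply: cvg_geometric; rewrite ger0_norm.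
have ab_cvg : b + geometric K theta n @[n --> \oo] --> b.
  by rewrite -[X in _ --> X]addr0; apply: cvgD => //; exact: cvg_cst.
rewrite -(cvg_lim (@Rhausdorff R) ab_cvg); apply: limr_ge.
  by apply/cvg_ex; exists b.
exact: nearW.
Qed.

(** The rate is explicit at every index: index 0 locates the limit relative to the initial term, and
    large indices let inequalities pass to the limit. *)
Lemma cvg_geometric_mdist (R : realType) (T : completeMetricType R)
    (theta K : R) (s : nat -> T) :
  0 <= theta < 1 -> (forall n, mdist (s n) (s n.+1) <= K * theta ^+ n) ->
  exists l, forall n, mdist (s n) l <= K / (1 - theta) * theta ^+ n.
Proof.
move=> theta01 sK; have /andP[t0 t1] := theta01.
have K0 : 0 <= K by have := le_trans (mdist_ge0 _ _) (sK 0%N); rewrite expr0 mulr1.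
set K' := K / (1 - theta).
have K'0 : 0 <= K' by rewrite divr_ge0 // subr_ge0 ltW.
have KE : K = K' * (1 - theta) by rewrite /K' divfK // subr_eq0 gt_eqF.
(* Keeping the exact partial sum of the series, with its factor [1 - theta ^+ k], lets the induction
   on [k] close. *)
have tail n k : mdist (s n) (s (n + k)%N) <= K' * theta ^+ n * (1 - theta ^+ k).
  elim: k => [|k IHk]; first by rewrite addn0 mdistxx expr0 subrr mulr0.
  have := metric_triangle (s n) (s (n + k)%N) (s (n + k.+1)%N).
  move=> /le_trans; apply; rewrite addnS.
  have := lerD IHk (sK (n + k)%N) => /le_trans; apply.
  rewrite KE exprD exprS; lra.
have tail_le n m : (n <= m)%N -> mdist (s n) (s m) <= K' * theta ^+ n.
  move=> /subnKC <-; apply: le_trans (tail _ _) _.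
  by apply: ler_piMr; [rewrite mulr_ge0 ?exprn_ge0|rewrite gerBl exprn_ge0].
have small e : 0 < e -> exists N, K' * theta ^+ N < e.
  move=> e0; apply: contrapT => /forallNP nsmall.
  have: e <= 0; last by rewrite leNgt e0.
  apply: (@le_add_geometric _ theta K') => // n.
  by rewrite add0r leNgt; apply/negP.
have /cauchy_cvgP : cauchy (s n @[n --> \oo]).
  apply/cauchy_ballP => e e0; rewrite near_map2.
  have [N sN] := small (e / 2) (divr_gt0 e0 (ltr0Sn _ 1)).
  exists ([set n | (N <= n)%N], [set n | (N <= n)%N]).
    by split; exists N.
  move=> [n m] /= [Nn Nm]; rewrite ballEmdist /=.
  have := tail_le _ _ Nn; have := tail_le _ _ Nm.
  have := metric_triangle (s n) (s N) (s m); rewrite (metric_sym (s n) (s N)).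
  lra.
move=> /cvg_ex[l sl]; exists l => n.
apply/ler_addgt0Pr => e e0.
have [N _ sN] := metricType_numDomainType.cvgr_dist_le sl e0.
(* A term past both [n] and [N] is within [K' * theta ^+ n] of [s n] and within [e] of [l]. *)
have := sN (maxn n N) (leq_maxr _ _); have := tail_le _ _ (leq_maxl n N).
have := metric_triangle (s n) (s (maxn n N)) l.
rewrite /= (metric_sym l); lra.
Qed.

Lemma metric_banach_fixed_point (R : realType) (T : completeMetricType R)
    (c : R) (phi : T -> T) : 0 <= c < 1 ->
  (forall x y, mdist (phi x) (phi y) <= c * mdist x y) -> exists x, x = phi x.
Proof.
move=> c01 phic; have /andP[c0 c1] := c01.
pose s n : T := iter n phi point.
have [|l sl] := @cvg_geometric_mdist R T c (mdist (s 0%N) (s 1%N)) s c01.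
  elim=> [|n IHn]; first by rewrite expr0 mulr1.
  apply: le_trans (phic _ _) _.
  by rewrite exprS mulrCA ler_wpM2l.
exists l; apply/esym/mdist_positivity/eqP; rewrite eq_le mdist_ge0 andbT.
set K := _ / _ in sl.
(* [phi l] is within [c * K * c ^+ n] of [s n.+1], which is within [K * c ^+ n.+1] of [l]: hence the
   factor 2. *)
apply: (@le_add_geometric _ c (2 * (c * K))) => // n.
have := metric_triangle (phi l) (s n.+1) l.
have := sl n.+1; have := phic l (s n); have := ler_wpM2l c0 (sl n).
rewrite (metric_sym (s n)) exprS add0r /=; lra.
Qed.

(** * From extended-real suprema to pointwise inequalities *)

Lemma LipP (R : realType) (A B : metricType R) (f : A -> B) (L : R) : 0 <= L ->
  (Lip f <= L%:E)%E <-> forall x y, mdist (f x) (f y) <= L * mdist x y.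
Proof.
move=> L0; split=> [fL x y|fL].
  have := le_trans (ereal_sup_ubound (ex_intro2 _ _ (x, y) I erefl)) fL.
  have [->|xy] := eqVneq x y; first by rewrite !mdistxx mulr0.
  by rewrite lee_fin ler_pdivrMr // mdist_gt0.
apply: ge_ereal_sup => _ [[x y] _ <-] /=; rewrite lee_fin.
have [->|xy] := eqVneq x y; first by rewrite !mdistxx mul0r.
by rewrite ler_pdivrMr // mdist_gt0.
Qed.

Lemma dtilde_rangeP (R : realType) (S : Type) (T : metricType R) (f : S -> T)
    (z : T) (r : R) :
  (dtilde (range f) z <= r%:E)%E <-> forall x, mdist (f x) z <= r.
Proof.
split=> [fr x|fr].
  rewrite -lee_fin; apply: le_trans fr; apply: ereal_sup_ubound.
  by exists (f x) => //; exists x.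
by apply: ge_ereal_sup => _ [_ [x _ <-] <-]; rewrite lee_fin.
Qed.

Lemma supE_lt1P (R : realType) (M : Type) (g : M -> R) : (supE g < 1)%E ->
  exists2 c : R, 0 <= c < 1 & forall m, g m <= c.
Proof.
move=> g1; have gub m : ((g m)%:E <= supE g)%E.
  by apply: ereal_sup_ubound; exists m.
case: (supE g) g1 gub => [s| |] //= s1 gub.
- exists (Num.max 0 s).
    by rewrite le_max lexx /= gt_max ltr01 /= -lte_fin.
  by move=> m; rewrite le_max orbC -lee_fin gub.
(* The supremum is -oo only over an empty [M], where the bound by 0 is vacuous. *)
- by exists 0; rewrite ?lexx ?ltr01 // => m; have := gub m.
Qed.

Lemma supE_ltyP (R : realType) (M : Type) (g : M -> R) : (supE g < +oo)%E ->
  exists c : R, forall m, g m <= c.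
Proof.
move=> gy; have gub m : ((g m)%:E <= supE g)%E.
  by apply: ereal_sup_ubound; exists m.
case: (supE g) gy gub => [s| |] //= _ gub.
- by exists s => m; rewrite -lee_fin.
- by exists 0 => m; have := gub m.
Qed.

Lemma condA'P (R : realType) (X1 Y1 X2 Y2 : metricType R)
    (F : X1 -> Y2 -> X2) (G : X1 -> Y2 -> Y1) (a lu : R) :
  0 <= a -> 0 <= lu -> condA' F G a lu ->
  (forall x y y', mdist (F x y) (F x y') <= a * mdist y y') /\
  (forall x y y', mdist (G x y) (G x y') <= lu * mdist y y').
Proof.
move=> a0 lu0 [Fa Glu].
split=> x; apply/LipP => //; [apply: le_trans Fa|apply: le_trans Glu];
  by apply: ereal_sup_ubound; exists x.
Qed.

(** * The graph transform and its fixed point *)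

Section GraphTransform.
Context (R : realType) (M : Type) (X Y : metric_bundle R M) (u : M -> M)
  (H : bundle_corr X Y u) (F : forall m, X m -> Y (u m) -> X (u m))
  (G : forall m, X m -> Y (u m) -> Y m) (i : prod_section X Y).
(** [a] stands for [alpha] under (A') and for [alpha'] under (A); [theta] is the rate of
    contraction. *)
Context (eps1 a lambda_u lambda_s beta' : M -> R) (c theta C A : R).
Arguments F : clear implicits.
Arguments G : clear implicits.

Definition lip_bundle (b : M -> R) (f : bundle_map X Y) : Prop :=
  forall m x x', mdist (f m x) (f m x') <= b m * mdist x x'.

Definition near_bundle (eta : M -> R) (K : R) (f g : bundle_map X Y) : Prop :=
  forall m x, mdist (f m x) (g m x) <= K * eta m.

(** As a relation, this makes invariance of [f] the statement [transform f f] and supplies the graph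
    points to which (A) and (B) apply. *)
Definition transform (f g : bundle_map X Y) : Prop :=
  forall m x, exists z, H m (x, g m x) (z, f (u m) z).

Definition transform_orbit (f : nat -> bundle_map X Y) : Prop :=
  forall n, lip_bundle beta' (f n) /\ transform (f n) (f n.+1).

(** Stated with [eps1], so as to cover [eta] and every competing [eta'] at once. *)
Definition decays (eta : M -> R) : Prop :=
  nonneg_fun eta /\ forall m, eta (u m) <= eps1 m * eta m.

(** Both (A') and (A) lead here, with [C] equal to 1 and [(1 - c)^-1]. Whole orbits are compared, so
    that [C] is lost once and not at every step. *)
Definition transform_contracting : Prop :=
  forall eta, decays eta -> forall f g, transform_orbit f ->
  transform_orbit g -> forall K, near_bundle eta K (f 0%N) (g 0%N) ->
  forall n, near_bundle eta (C * K * theta ^+ n) (f n) (g n).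

Hypothesis hgen : bundle_generated_by H F G.
Hypothesis a_ge0 : nonneg_fun a.
Hypothesis lu_ge0 : nonneg_fun lambda_u.
Hypothesis ls_ge0 : nonneg_fun lambda_s.
Hypothesis beta'_ge0 : nonneg_fun beta'.
Hypothesis F_lip :
  forall m x y y', mdist (F m x y) (F m x y') <= a m * mdist y y'.
Hypothesis G_lip :
  forall m x y y', mdist (G m x y) (G m x y') <= lambda_u m * mdist y y'.
Hypothesis ab_le : forall m, a m * beta' (u m) <= c.
Hypothesis c01 : 0 <= c < 1.

Lemma fiber_fixpoint_exists (f : bundle_map X Y) (m : M) (x : X m) :
  lip_bundle beta' f -> exists z, z = F m x (f (u m) z).
Proof.
move=> flip; apply: (@metric_banach_fixed_point R _ c) => // z z'.
apply: le_trans (F_lip _ _ _) _.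
apply: le_trans (ler_wpM2l (a_ge0 m) (flip _ _ _)) _.
by rewrite mulrA ler_wpM2r ?mdist_ge0 ?ab_le.
Qed.

Lemma transform_exists (f : bundle_map X Y) :
  lip_bundle beta' f -> exists g, transform f g.
Proof.
move=> flip; pose z m x := projT1 (cid (@fiber_fixpoint_exists f m x flip)).
exists (fun m x => G m x (f (u m) (z m x))) => m x; exists (z m x).
by apply/hgen; split=> //; rewrite /z; case: cid.
Qed.

(** The base points [z], [w] of the two images differ, but the distance D of [f z] and [g w]
    satisfies D <= K + beta' |z - w| <= K + a beta' D, which is solved for D. *)
Lemma transform_dist (f g f' g' : bundle_map X Y) (m : M) (K : R) :
  lip_bundle beta' g -> transform f f' -> transform g g' ->
  (forall z, mdist (f (u m) z) (g (u m) z) <= K) ->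
  forall x, mdist (f' m x) (g' m x)
    <= lambda_u m / (1 - a m * beta' (u m)) * K.
Proof.
move=> glip ff' gg' fgK x.
have [z /hgen[-> zE]] := ff' m x; have [w /hgen[-> wE]] := gg' m x.
apply: le_trans (G_lip _ _ _) _.
rewrite -mulrA ler_wpM2l //.
have /andP[_ c1] := c01; have abm := ab_le m.
rewrite ler_pdivlMl; last by lra.
have zw : mdist z w <= a m * mdist (f (u m) z) (g (u m) w).
  by rewrite {1}zE {1}wE; exact: F_lip.
have := metric_triangle (f (u m) z) (g (u m) z) (g (u m) w).
have := fgK z; have := glip _ z w; have := ler_wpM2l (beta'_ge0 (u m)) zw.
lra.
Qed.

Hypothesis H_B : forall m, condB (H m) (beta' (u m)) (beta' m) (lambda_s m).

(** Any two points on the graph of [f] over [u m] satisfy the premise of (B) with slope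
    [beta' (u m)]. *)
Lemma transform_lip (f g : bundle_map X Y) (xi : forall m, X m -> X (u m)) :
  lip_bundle beta' f ->
  (forall m x, H m (x, g m x) (xi m x, f (u m) (xi m x))) ->
  lip_bundle beta' g /\
  forall m x x', mdist (xi m x) (xi m x') <= lambda_s m * mdist x x'.
Proof.
move=> flip Hxi; split=> m x x';
  by have [] := H_B (Hxi m x) (Hxi m x') (flip _ _ _).
Qed.

Lemma transform_lip_exists (f : bundle_map X Y) :
  lip_bundle beta' f -> exists2 g, lip_bundle beta' g & transform f g.
Proof.
move=> flip; have [g fg] := transform_exists flip; exists g => //.
pose xi m x := projT1 (cid (fg m x)).
have [] // := @transform_lip f g xi flip.
by move=> m x; rewrite /xi; case: cid.
Qed.

Lemma transform_orbit_exists (f0 : bundle_map X Y) : lip_bundle beta' f0 ->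
  exists2 f, transform_orbit f & f 0%N = f0.
Proof.
move=> f0lip.
pose S := {f : bundle_map X Y | lip_bundle beta' f}.
have next (f : S) : {g : S | transform (sval f) (sval g)}.
  apply: cid; have [g glip fg] := transform_lip_exists (svalP f).
  by exists (exist _ g glip).
pose s n : S := iter n (fun f => sval (next f)) (exist _ f0 f0lip).
exists (fun n => sval (s n)) => // n; split; first exact: svalP.
by rewrite /s /=; exact: (svalP (next _)).
Qed.

Hypothesis theta01 : 0 <= theta < 1.
Hypothesis H_contr : transform_contracting.

Lemma invariant_bundle_exists (eta : M -> R) : decays eta ->
  (forall m x, mdist (G m x (i (u m)).2) (i m).2 <= eta m) ->
  exists f, [/\ lip_bundle beta' f, transform f f &
    exists2 K, 0 <= K & forall m x, mdist (f m x) (i m).2 <= K * eta m].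
Proof.
move=> eta_d Gi; have [eta0 _] := eta_d; have /andP[t0 t1] := theta01.
have ilip : lip_bundle beta' (fun m _ => (i m).2).
  by move=> m x x'; rewrite mdistxx mulr_ge0 ?mdist_ge0.
have [s s_orb s0] := transform_orbit_exists ilip.
have s_dist n m x : mdist (s n m x) (s n.+1 m x) <= C * eta m * theta ^+ n.
  (* The shifted orbit is again an orbit, so contraction bounds consecutive terms; the first step
     costs at most [eta] by the assumption on [G]. *)
  have s1_orb : transform_orbit (fun k => s k.+1) by move=> k; exact: s_orb.
  rewrite -mulrA (mulrC (eta m)) mulrA -[C]mulr1.
  apply: (H_contr eta_d s_orb s1_orb) => {}m {}x.
  have [_ /(_ m x)[z /hgen[-> _]]] := s_orb 0%N.
  by rewrite s0 mul1r metric_sym.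
pose K m := C * eta m / (1 - theta).
have lim m x := @cvg_geometric_mdist R _ _ _ (fun n => s n m x) theta01
  (fun n => s_dist n m x).
pose f : bundle_map X Y := fun m x => projT1 (cid (lim m x)).
have sf n m x : mdist (s n m x) (f m x) <= K m * theta ^+ n.
  by rewrite /f; case: cid.
have flip : lip_bundle beta' f.
  move=> m x x'; apply: (@le_add_geometric _ theta (2 * K m)) => // n.
  have [/(_ m x x') slip _] := s_orb n.
  have := metric_triangle (f m x) (s n m x) (f m x').
  have := metric_triangle (s n m x) (s n m x') (f m x').
  have := sf n m x; have := sf n m x'; rewrite (metric_sym (f m x) (s n m x)); lra.
have [g fg] := transform_exists flip.
exists f; split=> //.
  suff gf m x : g m x = f m x by move=> m x; rewrite -gf; exact: fg.
  apply: mdist_positivity; apply/eqP; rewrite eq_le mdist_ge0 andbT.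
  set q := lambda_u m / (1 - a m * beta' (u m)).
  (* Both [g] and [s n.+1] are transforms, of [f] and [s n]: the first summand bounds their
     distance, the second that of [s n.+1] and [f]. *)
  apply: (@le_add_geometric _ theta (q * K (u m) + K m * theta)) => // n.
  have [_ s_step] := s_orb n.
  have := transform_dist flip s_step fg (fun z => sf n (u m) z) x.
  have := metric_triangle (g m x) (s n.+1 m x) (f m x).
  have := sf n.+1 m x; rewrite (metric_sym (g m x) (s _ _ _)) exprS -/q; lra.
(* The sign of [C] is free here; if it is negative, the bound at index 0 is nonpositive and the
   constant 0 works. *)
have [C0|C0] := leP 0 C; last first.
  exists 0 => // m x; have := sf 0%N m x; rewrite s0 metric_sym mul0r.
  move=> /le_trans; apply; rewrite expr0 mulr1 /K -mulrA -oppr_ge0 -mulNr.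
  by rewrite mulr_ge0 ?oppr_ge0 ?(ltW C0) // divr_ge0 // subr_ge0 ltW.
exists (C / (1 - theta)); first by rewrite divr_ge0 // subr_ge0 ltW.
move=> m x; have := sf 0%N m x; rewrite s0 metric_sym expr0 mulr1.
by rewrite /K mulrAC.
Qed.

(** Invariant maps are constant orbits, so their fixed distance is bounded by a null sequence. *)
Lemma invariant_bundle_unique (eta : M -> R) (K : R) (f g : bundle_map X Y) :
  decays eta -> lip_bundle beta' f -> lip_bundle beta' g ->
  transform f f -> transform g g -> near_bundle eta K f g -> f = g.
Proof.
move=> eta_d flip glip ff gg fgK.
apply/functional_extensionality_dep => m; apply/funext => x.
apply: mdist_positivity; apply/eqP; rewrite eq_le mdist_ge0 andbT.
apply: (@le_add_geometric _ theta (C * K * eta m)) => // n.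
rewrite add0r mulrAC.
exact: (H_contr eta_d (f := fun=> f) (g := fun=> g)).
Qed.

Hypothesis a_le : forall m, a m <= A.

Lemma lipschitz_nearP (eta : M -> R) (f : bundle_map X Y) :
  lipschitz_near i beta' eta f <-> lip_bundle beta' f /\
  exists2 K, 0 <= K & forall m x, mdist (f m x) (i m).2 <= K * eta m.
Proof.
split=> [[K K0 fK]|[flip [K K0 fK]]].
  split=> [m|]; first by apply/LipP => //; case: (fK m).
  by exists K => // m; apply/dtilde_rangeP; case: (fK m).
by exists K => // m; split; [apply/LipP|apply/dtilde_rangeP].
Qed.

Lemma invariant_graphP (f : bundle_map X Y) : lip_bundle beta' f ->
  invariant_graph H lambda_s f <-> transform f f.
Proof.
move=> flip; split=> [[_ [xi [Hxi _]]] m x|ff].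
  by exists (xi m x); exact: Hxi.
split.
  move=> m [x y]; rewrite /fun_graph /= => ->.
  by have [z Hz] := ff m x; exists (z, f (u m) z).
exists (fun m x => projT1 (cid (ff m x))).
have Hxi m x : H m (x, f m x)
    (projT1 (cid (ff m x)), f (u m) (projT1 (cid (ff m x)))).
  by case: cid.
split=> // m; apply/LipP => //.
exact: (transform_lip flip Hxi).2.
Qed.

Lemma invariant_base_estimate (eta : M -> R) (f : bundle_map X Y) :
  lipschitz_near i beta' eta f -> base_estimate H F i lambda_s eta f.
Proof.
move=> /lipschitz_nearP[flip [K K0 fK]] Fi xi [Hxi _].
(* The 1 is for [F] evaluated at the section; replacing the section by [f] moves [F] by at most
   [A * K * eta (u m)]. *)
exists (1 + A * K) => m; apply/dtilde_rangeP => x.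
have /hgen[_ xiE] := Hxi m x.
have /dtilde_rangeP/(_ x) := Fi m.
have := metric_triangle (xi m x) (F m x (i (u m)).2) (i (u m)).1.
rewrite {2}xiE; have := F_lip x (f (u m) (xi m x)) (i (u m)).2.
have := ler_pM (a_ge0 m) (mdist_ge0 _ _) (a_le m) (fK (u m) (xi m x)).
lra.
Qed.

Lemma the_invariant_graph_exists (eps eta : M -> R) :
  nonneg_fun eta ->
  (forall m,
    (dtilde (range (fun x => G m x (i (u m)).2)) (i m).2 <= (eta m)%:E)%E) ->
  (forall m, eta (u m) <= eps m * eta m) ->
  (forall m, 0 <= eps m /\ eps m <= eps1 m) ->
  exists f : bundle_map X Y,
    the_invariant_graph H F i beta' lambda_s eta f /\
    (forall eta' eps' : M -> R,
       nonneg_fun eta' ->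
       (forall m, [/\ eta' (u m) <= eps' m * eta' m,
                      eps' m <= eps1 m & eta m <= eta' m]) ->
       the_invariant_graph H F i beta' lambda_s eta' f).
Proof.
move=> eta0 Gi eta_u heps.
have eta_d : decays eta.
  split=> // m; apply: le_trans (eta_u m) _.
  by rewrite ler_wpM2r //; case: (heps m).
have [f [flip ff [K K0 fK]]] :=
  invariant_bundle_exists eta_d (fun m => (dtilde_rangeP _ _ _).1 (Gi m)).
(* The map [f] built from [eta] keeps its constant [K] for a larger weight; uniqueness is then
   proved in the larger class belonging to [eta']. *)
have main eta' : decays eta' -> (forall m, eta m <= eta' m) ->
    the_invariant_graph H F i beta' lambda_s eta' f.
  move=> eta'_d eta_le.
  have fK' m x : mdist (f m x) (i m).2 <= K * eta' m.
    by apply: le_trans (fK m x) _; rewrite ler_wpM2l.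
  have f_near : lipschitz_near i beta' eta' f.
    by apply/lipschitz_nearP; split=> //; exists K.
  split; last exact: invariant_base_estimate.
  split; first by split=> //; apply/invariant_graphP.
  move=> g [/lipschitz_nearP[glip [K' K'0 gK']] /(invariant_graphP glip) gg].
  apply: (invariant_bundle_unique (K := K + K') eta'_d) => // m x.
  have := metric_triangle (f m x) (i m).2 (g m x).
  have := fK' m x; have := gK' m x; rewrite (metric_sym (g m x)); lra.
exists f; split; first exact: main.
move=> eta' eps' eta'0 eta'P; apply: main.
  split=> // m; have [eta'_u eps'_le _] := eta'P m.
  by apply: le_trans eta'_u _; rewrite ler_wpM2r.
by move=> m; case: (eta'P m).
Qed.

End GraphTransform.

(** * Contraction of the transform under (A') and under (A) *)

Section Contraction.
Context (R : realType) (M : Type) (X Y : metric_bundle R M) (u : M -> M)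
  (H : bundle_corr X Y u).
Context (eps1 : M -> R) (beta' lambda_u : M -> R) (c theta : R).
Hypothesis beta'_ge0 : nonneg_fun beta'.
Hypothesis lu_ge0 : nonneg_fun lambda_u.
Hypothesis c01 : 0 <= c < 1.
Hypothesis theta01 : 0 <= theta < 1.

(** One step brings the factor of [transform_dist] and replaces [eta m] by [eta (u m)]; together
    they cost at most [theta]. *)
Lemma condA'_contracting (F : forall m, X m -> Y (u m) -> X (u m))
    (G : forall m, X m -> Y (u m) -> Y m) (a : M -> R) :
  bundle_generated_by H F G ->
  (forall m x y y', mdist (F m x y) (F m x y') <= a m * mdist y y') ->
  (forall m x y y', mdist (G m x y) (G m x y') <= lambda_u m * mdist y y') ->
  (forall m, a m * beta' (u m) <= c) ->
  (forall m, lambda_u m * eps1 m / (1 - a m * beta' (u m)) <= theta) ->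
  transform_contracting H eps1 beta' theta 1.
Proof.
move=> hgen F_lip G_lip abc lu_theta eta [eta0 eta_u] f g f_orb g_orb K fgK.
have K_eta m : 0 <= K * eta m by apply: le_trans (mdist_ge0 _ _) (fgK m point).
have /andP[t0 _] := theta01; have /andP[_ c1] := c01.
elim=> [|n IHn] m x; first by rewrite expr0 mul1r mulr1.
have [[_ f_step] [glip g_step]] := (f_orb n, g_orb n).
have := transform_dist hgen lu_ge0 beta'_ge0 F_lip G_lip abc c01 glip
  f_step g_step (IHn (u m)) x.
move=> /le_trans; apply.
set q := lambda_u m / _.
have q_theta : q * eps1 m <= theta by rewrite /q mulrAC.
have q0 : 0 <= q by rewrite /q divr_ge0 // subr_ge0 (le_trans (abc m)) // ltW.
have Kt0 : 0 <= K * theta ^+ n * eta m.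
  by rewrite mulrAC mulr_ge0 ?exprn_ge0.
have := ler_wpM2r Kt0 q_theta.
(* [K] may be negative, but [K * eta] is nonnegative, being above a distance at [point]; so
   [eta (u m)] vanishes in that case. *)
have [K0|K0] := leP 0 K.
  have := ler_wpM2l (mulr_ge0 q0 (mulr_ge0 K0 (exprn_ge0 n t0))) (eta_u m).
  rewrite exprS; lra.
have eta_um : eta (u m) = 0.
  by apply/eqP; rewrite eq_le eta0 andbT -(nmulr_rge0 _ K0).
rewrite eta_um !mulr0 => _.
by rewrite mul1r mulrAC mulr_ge0 ?exprn_ge0.
Qed.

(* The induction on [n] is over pairs of points in the cone
   [|x - x'| <= k |y - y'|], which condition (A) maps into itself; the factor
   [1 / (1 - c)] is lost only once, at the end of the orbit. *)
Lemma condA_contracting (alpha alpha' : M -> R) :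
  nonneg_fun alpha -> nonneg_fun alpha' ->
  (forall m, condA (H m) (alpha m) (alpha' m) (lambda_u m)) ->
  (forall m, alpha' m <= alpha (u m)) ->
  (forall m, alpha' m * beta' (u m) <= c) ->
  (forall m, lambda_u m * eps1 m <= theta) ->
  transform_contracting H eps1 beta' theta (1 - c)^-1.
Proof.
move=> al0 al'0 HA al_le abc lu_theta eta [eta0 eta_u] f g f_orb g_orb K fgK.
have K_eta m : 0 <= K * eta m by apply: le_trans (mdist_ge0 _ _) (fgK m point).
have /andP[t0 _] := theta01; have /andP[c0 c1] := c01.
have cone n m k x x' : 0 <= k <= alpha m -> k * beta' m <= c ->
    mdist x x' <= k * mdist (f n m x) (g n m x') ->
    mdist (f n m x) (g n m x') <= (1 - c)^-1 * K * theta ^+ n * eta m.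
  elim: n m k x x' => [|n IHn] m k x x' /andP[k0 k_le] kbc xx'.
    (* Going from [x] to [x'] along [g] costs at most [beta' m * k <= c] times the distance being
       estimated, whence [(1 - c)^-1]. *)
    rewrite expr0 mulr1 -mulrA ler_pdivlMl; last by rewrite subr_gt0.
    have [glip _] := g_orb 0%N.
    have := metric_triangle (f 0%N m x) (g 0%N m x) (g 0%N m x').
    have := fgK m x; have := glip m x x'; have := ler_wpM2l (beta'_ge0 m) xx'.
    have := ler_wpM2r (mdist_ge0 (f 0%N m x) (g 0%N m x')) kbc; lra.
  have [_ /(_ m x)[z Hz]] := f_orb n; have [_ /(_ m x')[w Hw]] := g_orb n.
  have [|zw yy'] := HA m _ _ _ _ _ _ _ _ Hz Hw.
    by apply: le_trans xx' _; rewrite ler_wpM2r ?mdist_ge0.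
  apply: le_trans yy' _.
  (* The new slope [alpha' m] meets both side conditions of [cone] at [u m]. *)
  have al'_le : 0 <= alpha' m <= alpha (u m) by rewrite al'0 al_le.
  have := ler_wpM2l (lu_ge0 m) (IHn _ _ _ _ al'_le (abc m) zw).
  move=> /le_trans; apply.
  have D0 : 0 <= (1 - c)^-1 by rewrite invr_ge0 subr_ge0 ltW.
  have Kt0 j : 0 <= (1 - c)^-1 * K * theta ^+ j * eta m.
    rewrite mulrAC -(mulrA _ K); apply: mulr_ge0 (exprn_ge0 _ t0).
    exact: mulr_ge0.
  have := ler_wpM2r (Kt0 n) (lu_theta m).
  have [K0|K0] := leP 0 K.
    have := ler_wpM2l (mulr_ge0 (lu_ge0 m)
      (mulr_ge0 (mulr_ge0 D0 K0) (exprn_ge0 n t0))) (eta_u m).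
    rewrite exprS; lra.
  have eta_um : eta (u m) = 0.
    by apply/eqP; rewrite eq_le eta0 andbT -(nmulr_rge0 _ K0).
  by rewrite eta_um !mulr0.
(* Slope 0 is the case of a common base point. *)
move=> n m x; apply: (cone n m 0); rewrite ?mul0r ?mdistxx ?lexx //.
exact: al0.
Qed.

End Contraction.

(** * Reduction of both sets of hypotheses to the graph transform *)

Theorem theorem4p3 (R : realType) (M : Type) (X Y : metric_bundle R M)
    (u : M -> M) (H : bundle_corr X Y u)
    (F : forall m, X m -> Y (u m) -> X (u m))
    (G : forall m, X m -> Y (u m) -> Y m)
    (i : prod_section X Y)
    (eps1 eps eta : M -> R)
    (alpha alpha' beta beta' lambda_u lambda_s : M -> R)
    (hgen : bundle_generated_by H F G)
    (heps1 : nonneg_fun eps1)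
    (heta : nonneg_fun eta)
    (hi : forall m,
      (dtilde (range (fun x => G m x (i (u m)).2)) (i m).2 <= (eta m)%:E)%E)
    (heta_u : forall m, eta (u m) <= eps m * eta m)
    (heps : forall m, 0 <= eps m /\ eps m <= eps1 m)
    (hii : condA'B_hyps H F G eps1 alpha beta beta' lambda_u lambda_s \/
           condAB_hyps H eps1 alpha alpha' beta beta' lambda_u lambda_s) :
  exists f : bundle_map X Y,
    the_invariant_graph H F i beta' lambda_s eta f /\
    (forall eta' eps' : M -> R,
       nonneg_fun eta' ->
       (forall m, [/\ eta' (u m) <= eps' m * eta' m,
                      eps' m <= eps1 m & eta m <= eta' m]) ->
       the_invariant_graph H F i beta' lambda_s eta' f).
Proof.
case: hii => [[[al0 lu0 b0 b'0 ls0] [HA' HB] [ab_lt b'b ab_bd] lu_lt]|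
  [[al'0 [al0 lu0 b0 b'0 ls0]] [HA HB] [ab_lt al'al b'b ab_bd] lu_lt]].
all: have [c c01 abc] := supE_lt1P ab_lt.
all: have [theta theta01 lu_theta] := supE_lt1P lu_lt.
all: have [A A_bd] := supE_ltyP ab_bd.
all: have HB' m : condB (H m) (beta' (u m)) (beta' m) (lambda_s m)
  by move=> x1 y1 x2 y2 x1' y1' x2' y2' h h' le_b';
     apply: (HB m _ _ _ _ _ _ _ _ h h'); apply: le_trans le_b' _;
     rewrite ler_wpM2r ?mdist_ge0.
all: have al_le m : alpha m <= A
  by apply: le_trans (A_bd m); rewrite le_max lexx.
- have F_lip m := (condA'P (al0 m) (lu0 m) (HA' m)).1.
  have G_lip m := (condA'P (al0 m) (lu0 m) (HA' m)).2.
  have contr := condA'_contracting b'0 lu0 c01 theta01 hgen F_lip G_lip abc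
    lu_theta.
  exact: (the_invariant_graph_exists hgen al0 lu0 ls0 b'0 F_lip G_lip abc c01 HB'
    theta01 contr al_le heta hi heta_u heps).
(* Two graph points with the same [x] satisfy the premise of (A) trivially, so (A) yields Lipschitz
   bounds in the second argument, with [alpha'] in the role of [alpha]. *)
- have FG_lip m x y y' :
      mdist (F m x y) (F m x y') <= alpha' m * mdist y y' /\
      mdist (G m x y) (G m x y') <= lambda_u m * mdist y y'.
    apply: (HA m x (G m x y) _ _ x (G m x y')).
    - exact/hgen.
    - exact/hgen.
    - by rewrite mdistxx mulr_ge0 ?mdist_ge0.
  have al'_le m : alpha' m <= A := le_trans (al'al m) (al_le (u m)).
  have contr := condA_contracting b'0 lu0 c01 theta01 al0 al'0 HA al'al abc
    lu_theta.
  exact: (the_invariant_graph_exists hgen al'0 lu0 ls0 b'0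
    (fun m x y y' => (FG_lip m x y y').1) (fun m x y y' => (FG_lip m x y y').2)
    abc c01 HB' theta01 contr al'_le heta hi heta_u heps).
Qed.
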